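(* Let $V_1,V_2,V_3,W_1,W_2,W_3,V_1',V_2',W_1',W_2'$ be finite-dimensional complex vector spaces, let $s\in V_1\otimes V_2\otimes V_3$ and $t\in W_1\otimes W_2\otimes W_3$ be tensors, and let $F_1:V_1\otimes V_2\otimes V_3\to V_1'\otimes V_2'$ and $F_2:W_1\otimes W_2\otimes W_3\to W_1'\otimes W_2'$ be nonzero linear maps. Then the border rank of the 6-tensor $s\otimes t\in V_1\otimes V_2\otimes V_3\otimes W_1\otimes W_2\otimes W_3$ satisfies \[ \underline{\mathrm{R}}(s\otimes t)\ \ge\ \frac{\mathrm{R}(F_1(s))}{\max \mathrm{R}(F_1(v_1\otimes v_2\otimes v_3))}\cdot\frac{\mathrm{R}(F_2(t))}{\max \mathrm{R}(F_2(w_1\otimes w_2\otimes w_3))}, \] where the maximisations are over all simple tensors $v_1\otimes v_2\otimes v_3$ in $V_1\otimes V_2\otimes V_3$ and $w_1\otimes w_2\otimes w_3$ in $W_1\otimes W_2\otimes W_3$, respectively.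
   Context: The tensor rank $\mathrm{R}(t)$ of $t\in U_1\otimes\cdots\otimes U_k$ is the smallest $r$ such that $t$ is a sum of $r$ simple tensors $u_1\otimes\cdots\otimes u_k$; for an element of a tensor product of two spaces this is matrix rank. The border rank $\underline{\mathrm{R}}(t)$ is the smallest $r$ such that $t$ is a limit (in the Euclidean topology) of a sequence of tensors in $U_1\otimes\cdots\otimes U_k$ of rank at most $r$. The tensor product $s\otimes t$ is a 6-tensor; no factors are grouped. *)

(* Defs.v *)
From HB Require Import structures.
From mathcomp Require Import all_boot all_order all_algebra.
From mathcomp Require Import complex.
From mathcomp Require Import boolp classical_sets reals topology normedtype.
From mathcomp Require Import sequences.

Set Implicit Arguments.
Unset Strict Implicit.
Unset Printing Implicit Defensive.

Import Order.TTheory GRing.Theory Num.Theory.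
Import numFieldNormedType.Exports.
Import passmx.

Local Open Scope classical_set_scope.
Local Open Scope ring_scope.

(* MathComp-Analysis attaches the modulus topology to an abstract
   numClosedFieldType, not to the concrete type complex R. *)
Definition cplx (R : realType) : numClosedFieldType := complex R.

(* A formal (parenthesised) tensor product of finite-dimensional complex
   vector spaces, remembering the list of its factors. Rank is relative to this
   list, so it cannot be read off the vector space tspace T alone: a matrix
   space may be a single factor or a product of two. *)
Inductive tshape (R : realType) : Type :=
  | TFactor of vectType (cplx R)
  | TProd of tshape R & tshape R.

Coercion TFactor : Vector.type >-> tshape.

Declare Scope tensor_scope.
Delimit Scope tensor_scope with T.
Bind Scope tensor_scope with tshape.
Notation "U ⊗ V" := (TProd U V) (at level 40, left associativity)
  : tensor_scope.

Definition coords (K : fieldType) (V : vectType K) : V -> 'rV[K]_(\dim {:V}) :=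
  rVof (vbasis {:V}).

(* The product of two spaces of dimensions m and n is modelled by m x n
   matrices: coordinates in the tensor product of two fixed bases. *)
Fixpoint tspace (R : realType) (T : tshape R) : vectType (cplx R) :=
  match T with
  | TFactor V => V
  | TProd A B => 'M[cplx R]_(\dim {:tspace A}, \dim {:tspace B})
  end.

Definition tprod (R : realType) (A B : tshape R)
    (x : tspace A) (y : tspace B) : tspace (A ⊗ B) :=
  (coords x)^T *m coords y.
Notation "x ⊗ y" := (tprod x y) (at level 40, left associativity) : ring_scope.

(* The vectors u_1 ⊗ ... ⊗ u_k, with one u_i in each factor of T. *)
Fixpoint simple_tensor (R : realType) (T : tshape R) : set (tspace T) :=
  match T with
  | TFactor V => [set: V]
  | TProd A B => [set z | exists x y,
      [/\ simple_tensor x, simple_tensor y & z = tprod x y]]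
  end.

Definition sum_of_simple (R : realType) (T : tshape R) (t : tspace T)
    (r : nat) : Prop :=
  exists u : 'I_r -> tspace T,
    (forall i, simple_tensor (u i)) /\ t = \sum_(i < r) u i.

Fixpoint trank_bound (R : realType) (T : tshape R) : nat :=
  match T with
  | TFactor V => 1
  | TProd A B => trank_bound A * trank_bound B * \dim {:tspace B}
  end.

Section RankExists.
Variable R : realType.
Implicit Types T A B : tshape R.

Lemma tprod_sum A B I J (r : seq I) (q : seq J)
    (x : I -> tspace A) (y : J -> tspace B) :
  tprod (\sum_(i <- r) x i) (\sum_(j <- q) y j) =
  \sum_(i <- r) \sum_(j <- q) tprod (x i) (y j).
Proof.
rewrite /tprod /coords [rVof _ (\sum_(i <- r) _)]linear_sum linear_sum mulmx_suml.
apply: eq_bigr => i _.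
by rewrite [rVof _ (\sum_(j <- q) _)]linear_sum mulmx_sumr.
Qed.

Lemma simple_tensor0 T : simple_tensor (0 : tspace T).
Proof.
elim: T => [//|A hA B hB] /=.
by exists 0, 0; split; rewrite // /tprod /coords [X in _ *m X]linear0 mulmx0.
Qed.

Lemma sum_of_simple_seq T (s : seq (tspace T)) :
  (forall x, x \in s -> simple_tensor x) ->
  sum_of_simple (\sum_(x <- s) x) (size s).
Proof.
move=> hs; exists (fun i => nth 0 s i); split.
  by move=> i; apply: hs; rewrite mem_nth.
by rewrite (big_nth 0) big_mkord.
Qed.

Lemma sum_of_simple_bound T (t : tspace T) : sum_of_simple t (trank_bound T).
Proof.
elim: T t => [V|A hA B hB] t /=.
  by exists (fun=> t); split=> //; rewrite big_ord1.
pose a j := vecof (vbasis {:_}) (\row_i (t : 'M_(_, _)) i j) : tspace A.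
pose b j := vecof (vbasis {:_}) (delta_mx 0 j) : tspace B.
have tE : t = \sum_j tprod (a j) (b j).
  apply/matrixP => i j; rewrite summxE (bigD1 j) //= big1 ?addr0.
    by rewrite /tprod /coords !(vecofK (vbasisP _)) !mxE big_ord1 !mxE !eqxx mulr1.
  move=> k kj; rewrite /tprod /coords !(vecofK (vbasisP _)) !mxE big_ord1 !mxE eqxx /=.
  by rewrite eq_sym (negPf kj) mulr0.
have /choice [u hu] j := hA (a j).
have /choice [v hv] j := hB (b j).
pose s := [seq tprod (u p.2 p.1.1) (v p.2 p.1.2) |
           p <- enum [the finType of
             ('I_(trank_bound A) * 'I_(trank_bound B) * 'I_(\dim {:tspace B}))%type]].
have -> : t = \sum_(x <- s) x.
  rewrite big_map big_enum /=.
  rewrite -(pair_bigA _ (fun p j => tprod (u j p.1) (v j p.2))) exchange_big.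
  rewrite tE; apply: eq_bigr => j _ /=.
  by rewrite {1}(hu j).2 {1}(hv j).2 tprod_sum pair_bigA.
have <- : size s = (trank_bound A * trank_bound B * \dim {:tspace B})%N.
  by rewrite size_map -cardE !card_prod !card_ord.
apply: sum_of_simple_seq => x /mapP[p _ ->] /=.
by exists (u p.2 p.1.1), (v p.2 p.1.2); split=> //; [exact: (hu p.2).1|exact: (hv p.2).1].
Qed.

Lemma trank_exists T (t : tspace T) : exists r, `[< sum_of_simple t r >].
Proof. by exists (trank_bound T); apply/asboolP/sum_of_simple_bound. Qed.

Definition trank T (t : tspace T) : nat := ex_minn (trank_exists t).

Lemma trank_le_bound T (t : tspace T) : (trank t <= trank_bound T)%N.
Proof.
rewrite /trank; case: ex_minnP => r _; apply.
by apply/asboolP/sum_of_simple_bound.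
Qed.

(* The Euclidean topology of a finite-dimensional space is that of its
   coordinates, the field of complex numbers being normed by the modulus. *)
Definition tensor_limit T (u : nat -> tspace T) (t : tspace T) : Prop :=
  (fun n => coords (u n)) @ \oo --> coords t.

Definition limit_of_rank_le T (t : tspace T) (r : nat) : Prop :=
  exists u : nat -> tspace T, (forall n, (trank (u n) <= r)%N) /\ tensor_limit u t.

Lemma border_rank_exists T (t : tspace T) :
  exists r, `[< limit_of_rank_le t r >].
Proof.
by exists (trank t); apply/asboolP; exists (fun=> t); split=> //; exact: cvg_cst.
Qed.

Definition border_rank T (t : tspace T) : nat := ex_minn (border_rank_exists t).

Definition simple_image_rank T T' (F : 'Hom(tspace T, tspace T')) (r : nat)
  : Prop := exists2 x : tspace T, simple_tensor x & trank (F x) = r.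

Lemma simple_image_rank_exists T T' (F : 'Hom(tspace T, tspace T')) :
  exists r, `[< simple_image_rank F r >].
Proof.
by exists (trank (F 0)); apply/asboolP; exists 0 => //; exact: simple_tensor0.
Qed.

Lemma simple_image_rank_bounded T T' (F : 'Hom(tspace T, tspace T')) r :
  `[< simple_image_rank F r >] -> (r <= trank_bound T')%N.
Proof. by move=> /asboolP[x _ <-]; exact: trank_le_bound. Qed.

Definition max_simple_rank T T' (F : 'Hom(tspace T, tspace T')) : nat :=
  ex_maxn (simple_image_rank_exists F) (@simple_image_rank_bounded _ _ F).

End RankExists.

(* Main.v *)
Require Import Defs.
From HB Require Import structures.
From mathcomp Require Import all_boot all_order all_algebra.
From mathcomp Require Import mxtens boolp classical_sets reals topology.
From mathcomp Require Import normedtype sequences.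
Set Implicit Arguments.
Unset Strict Implicit.
Unset Printing Implicit Defensive.
Import Order.TTheory GRing.Theory Num.Theory.
Import numFieldNormedType.Exports.
Import passmx.
Local Open Scope classical_set_scope.
Local Open Scope ring_scope.

(** Tensor the two maps and regroup the target: [F1] and [F2] together send the
    tensors on [(V1 ⊗ V2 ⊗ V3) ⊗ (W1 ⊗ W2 ⊗ W3)] linearly to matrices, namely
    to [(V1' ⊗ W1') ⊗ (V2' ⊗ W2')], in such a way that [v ⊗ w] goes to the
    Kronecker product of the matrices [F1 v] and [F2 w] ([kronecker_map],
    [kronecker_map_tprod]). Grouping factors is only done in the target, where
    it turns tensor rank into matrix rank, and matrix rank has two properties
    that tensor rank lacks: it is multiplicative under Kronecker products
    ([mxrank_tensmx]) and lower semicontinuous ([mxrank_limit_leq]).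

    Let [m1] and [m2] be the maximal ranks of [F1] and [F2] on simple tensors.
    By multiplicativity a simple tensor is sent to a matrix of rank at most
    [m1 * m2], hence a tensor of rank at most [r] to one of rank at most
    [r * (m1 * m2)] by subadditivity, and semicontinuity carries this bound
    over to limits, so that [r] may be a border rank
    ([mxrank_kronecker_border]). Applied to [s ⊗ t], whose image has rank
    [R(F1 s) * R(F2 t)], this is the inequality after clearing denominators. *)

(** Cuts out of [M] an identity block of maximal size by multiplying on both
    sides. Such a certificate [A *m M *m B = 1%:M] bounds the rank from below,
    and it survives both Kronecker products and small perturbations of [M]. *)
Lemma mxrank_factor1 (K : fieldType) m n (M : 'M[K]_(m, n)) :
  exists (A : 'M_(\rank M, m)) (B : 'M_(n, \rank M)), A *m M *m B = 1%:M.
Proof.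
have /row_fullP[A AM] := col_base_full M.
have /row_freeP[B MB] := row_base_free M.
exists A, B; rewrite -[X in A *m X]mulmx_base.
by rewrite mulmxA AM mul1mx MB.
Qed.

Lemma tensmx11 (K : comPzRingType) m n :
  1%:M *t 1%:M = 1%:M :> 'M[K]_(m * n).
Proof.
apply/matrixP=> i j.
case: (mxtens_indexP i) => i1 i2; case: (mxtens_indexP j) => j1 j2.
by rewrite tensmxE !mxE -natrM mulnb (can_eq (@mxtens_indexK _ _)) xpair_eqE.
Qed.

(** For the upper bound, rank factorisations of the two matrices multiply to a
    factorisation through [\rank A * \rank B] dimensions; for the lower bound,
    the identity blocks cut out of them multiply to an identity block. *)
Lemma mxrank_tensmx (K : fieldType) m n p q (A : 'M[K]_(m, n)) (B : 'M_(p, q)) :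
  \rank (A *t B) = (\rank A * \rank B)%N.
Proof.
apply/eqP; rewrite eqn_leq; apply/andP; split.
  rewrite -[in X in (X <= _)%N](mulmx_base A) -[in X in (X <= _)%N](mulmx_base B).
  by rewrite -tensmx_mul mulmx_max_rank.
have [A1 [A2 A12]] := mxrank_factor1 A.
have [B1 [B2 B12]] := mxrank_factor1 B.
rewrite -[leqLHS](@mxrank1 K) -tensmx11 -A12 -B12 -!tensmx_mul.
exact: leq_trans (mxrankM_maxl _ _) (mxrankM_maxr _ _).
Qed.

Lemma mxrank_sum_leq (K : fieldType) m n I (r : seq I) (A : I -> 'M[K]_(m, n)) :
  (\rank (\sum_(i <- r) A i)%R <= \sum_(i <- r) \rank (A i))%N.
Proof.
apply: (big_rec2 (fun M k => \rank M <= k)%N) => [|i M k _ leMk].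
  by rewrite mxrank0.
by apply: leq_trans (mxrank_add _ _) _; rewrite leq_add2l.
Qed.

Section Semicontinuity.
Variable K : numFieldType.

Lemma cvg_sumr I (r : seq I) (f : I -> nat -> K) (a : I -> K) :
  (forall i, f i @ \oo --> a i) ->
  \sum_(i <- r) f i n @[n --> \oo] --> \sum_(i <- r) a i.
Proof. by move=> fa; apply: cvg_big => //; exact: add_continuous. Qed.

Lemma cvg_prodr I (r : seq I) (f : I -> nat -> K) (a : I -> K) :
  (forall i, f i @ \oo --> a i) ->
  \prod_(i <- r) f i n @[n --> \oo] --> \prod_(i <- r) a i.
Proof. by move=> fa; apply: cvg_big => //; exact: mul_continuous. Qed.

(** Convergence of every entry is what sums and products of entries, hence
    [*m] and [\det], preserve directly. *)
Definition entrywise_cvg m n (u : nat -> 'M[K]_(m, n)) (M : 'M[K]_(m, n)) :=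
  forall i j, u k i j @[k --> \oo] --> M i j.

Lemma entrywise_cvg_mul m n p q (A : 'M[K]_(m, n)) (B : 'M[K]_(p, q))
    (u : nat -> 'M_(n, p)) (M : 'M_(n, p)) :
  entrywise_cvg u M -> entrywise_cvg (fun k => A *m u k *m B) (A *m M *m B).
Proof.
move=> uM i j; rewrite mxE; under eq_cvg do rewrite mxE.
apply: cvg_sumr => l; apply: cvgM; last exact: cvg_cst.
rewrite mxE; under eq_cvg do rewrite mxE.
by apply: cvg_sumr => h; apply: cvgM; [exact: cvg_cst|exact: uM].
Qed.

Lemma entrywise_cvg_det n (u : nat -> 'M[K]_n) (M : 'M[K]_n) :
  entrywise_cvg u M -> \det (u k) @[k --> \oo] --> \det M.
Proof.
move=> uM; apply: cvg_sumr => s; apply: cvgM; first exact: cvg_cst.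
by apply: cvg_prodr => i; exact: uM.
Qed.

(** Lower semicontinuity of the rank: if [A *m M *m B] is the identity of size
    [\rank M], then the determinants of the [A *m u k *m B] tend to [1], so one
    of these matrices is invertible and [u k] has rank at least [\rank M]. *)
Lemma mxrank_limit_leq m n (u : nat -> 'M[K]_(m, n)) (M : 'M[K]_(m, n)) r :
  entrywise_cvg u M -> (forall k, (\rank (u k) <= r)%N) -> (\rank M <= r)%N.
Proof.
move=> uM ur; have [A [B AMB]] := mxrank_factor1 M.
have := entrywise_cvg_det (entrywise_cvg_mul (A := A) (B := B) uM).
rewrite AMB det1 => /cvgr_neq0 /(_ (oner_neq0 _)) [k _ /(_ k (leqnn k))] /=.
rewrite -unitfE -[_ \is a _]/(_ \in unitmx) => /mxrank_unit <-.
exact: leq_trans (leq_trans (mxrankM_maxl _ _) (mxrankM_maxr _ _)) (ur k).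
Qed.

End Semicontinuity.

Lemma linear_coords (K : fieldType) (V : vectType K) (W : lmodType K)
    (f : {linear V -> W}) v :
  f v = \sum_i coords v 0 i *: f (vbasis {:V})`_i.
Proof.
rewrite {1}[v](coord_vbasis (memvf v)) linear_sum.
by apply: eq_bigr => i _; rewrite linearZ /coords mxE.
Qed.

Section TensorRank.
Variable R : realType.

Lemma linear_tensor_limit (T : tshape R) m n
    (f : {linear tspace T -> 'M[cplx R]_(m, n)}) (u : nat -> tspace T) t :
  tensor_limit u t -> entrywise_cvg (fun k => f (u k)) (f t).
Proof.
move=> ut i j; rewrite linear_coords summxE.
under eq_cvg do rewrite linear_coords summxE.
apply: cvg_sumr => l; rewrite mxE; under eq_cvg do rewrite mxE.
apply: cvgM; last exact: cvg_cst.
exact: (cvg_comp _ _ ut (@coord_continuous _ _ _ 0 l (coords t))).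
Qed.

Lemma trankP (T : tshape R) (t : tspace T) : sum_of_simple t (trank t).
Proof. by rewrite /trank; case: ex_minnP => r /asboolP. Qed.

Lemma trank_min (T : tshape R) (t : tspace T) r :
  sum_of_simple t r -> (trank t <= r)%N.
Proof. by move=> tr; rewrite /trank; case: ex_minnP => k _; apply; exact/asboolP. Qed.

Lemma trank_max_simple (T T' : tshape R) (F : 'Hom(tspace T, tspace T')) x :
  simple_tensor x -> (trank (F x) <= max_simple_rank F)%N.
Proof.
move=> xs; rewrite /max_simple_rank; case: ex_maxnP => r _; apply.
by apply/asboolP; exists x.
Qed.

(** For two factors, tensor rank is matrix rank: the columns and rows of a rank
    factorisation are the vectors of a shortest sum of simple tensors, and
    conversely each simple tensor has matrix rank at most one. *)
Lemma trank_mxrank (U V : vectType (cplx R)) (M : tspace (U ⊗ V)) :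
  trank M = \rank (M : 'M_(_, _)).
Proof.
apply/eqP; rewrite eqn_leq; apply/andP; split.
  apply: trank_min; exists (fun k =>
    tprod (A := U) (B := V)
          (vecof (vbasis {:U}) (col k (col_base (M : 'M_(_, _))))^T)
          (vecof (vbasis {:V}) (row k (row_base (M : 'M_(_, _)))))).
  split=> [k|]; first by eexists; eexists; split.
  rewrite -[LHS](@mulmx_base (cplx R)).
  apply/matrixP => i j; rewrite summxE mxE; apply: eq_bigr => k _.
  rewrite /tprod /coords !(vecofK (vbasisP _)) trmxK.
  by rewrite !mxE big_ord1 !mxE.
have [u [us {1}->]] := trankP M.
apply: leq_trans (mxrank_sum_leq _ _) _.
rewrite -[leqRHS]muln1 -[trank M in leqRHS]card_ord -sum_nat_const.
apply: leq_sum => k _; have [x [y [_ _ ->]]] := us k.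
exact: leq_trans (mxrankM_maxl _ _) (rank_leq_col _).
Qed.

Section Flattening.
Variables (A B : tshape R) (m n p q : nat).
Variables (f : {linear tspace A -> 'M[cplx R]_(m, n)}).
Variables (g : {linear tspace B -> 'M[cplx R]_(p, q)}).

(** The linear extension of [x ⊗ y |-> f x *t g y], written on the bases in
    which [tspace (A ⊗ B)] has its coordinates. *)
Definition kronecker_map (X : tspace (A ⊗ B)) : 'M[cplx R]_(m * p, n * q) :=
  \sum_i \sum_j (X : 'M_(_, _)) i j *:
    (f (vbasis {:tspace A})`_i *t g (vbasis {:tspace B})`_j).

Lemma kronecker_map_linear : linear kronecker_map.
Proof.
move=> a X Y; rewrite /kronecker_map scaler_sumr -big_split; apply: eq_bigr => i _.
rewrite scaler_sumr -big_split; apply: eq_bigr => j _.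
by rewrite !mxE scalerDl scalerA.
Qed.

HB.instance Definition _ := GRing.isLinear.Build _ _ _ _ kronecker_map
  kronecker_map_linear.

Lemma kronecker_map_tprod x y : kronecker_map (tprod x y) = f x *t g y.
Proof.
rewrite (linear_coords f x) (linear_coords g y).
apply/matrixP => k l; rewrite /kronecker_map [RHS]mxE !summxE big_distrl.
apply: eq_bigr => i _; rewrite summxE big_distrr; apply: eq_bigr => j _ /=.
by rewrite !mxE big_ord1 !mxE mulrACA.
Qed.

End Flattening.

(** The bound is linear in the number of simple summands, and closed under
    limits, so it holds with the border rank in place of the rank. *)
Lemma mxrank_kronecker_border (A B : tshape R) m n p q a b
    (f : {linear tspace A -> 'M[cplx R]_(m, n)})
    (g : {linear tspace B -> 'M[cplx R]_(p, q)}) (t : tspace (A ⊗ B)) :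
  (forall x, simple_tensor x -> (\rank (f x) <= a)%N) ->
  (forall y, simple_tensor y -> (\rank (g y) <= b)%N) ->
  (\rank (kronecker_map f g t) <= border_rank t * (a * b))%N.
Proof.
move=> fa gb; rewrite /border_rank; case: ex_minnP => r /asboolP[u [ur ut]] _.
apply: (mxrank_limit_leq (linear_tensor_limit (f := kronecker_map f g) ut)) => k.
apply: leq_trans (leq_mul (ur k) (leqnn _)).
have [w [ws {1}->]] := trankP (u k).
rewrite linear_sum; apply: leq_trans (mxrank_sum_leq _ _) _.
rewrite -[trank _ in leqRHS]card_ord -sum_nat_const.
apply: leq_sum => i _; have [x [y [xs ys ->]]] := ws i.
by rewrite /= kronecker_map_tprod mxrank_tensmx leq_mul ?fa ?gb.
Qed.

End TensorRank.

Theorem proposition20 (R : realType)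
    (V1 V2 V3 W1 W2 W3 V1' V2' W1' W2' : vectType (cplx R))
    (s : tspace (V1 ⊗ V2 ⊗ V3)) (t : tspace (W1 ⊗ W2 ⊗ W3))
    (F1 : 'Hom(tspace (V1 ⊗ V2 ⊗ V3), tspace (V1' ⊗ V2')))
    (F2 : 'Hom(tspace (W1 ⊗ W2 ⊗ W3), tspace (W1' ⊗ W2')))
    (F1_neq0 : F1 != 0) (F2_neq0 : F2 != 0) :
  ((trank (F1 s))%:R / (max_simple_rank F1)%:R)
    * ((trank (F2 t))%:R / (max_simple_rank F2)%:R)
  <= (border_rank (s ⊗ t))%:R :> R.
Proof.
have key : (trank (F1 s) * trank (F2 t) <=
    border_rank (s ⊗ t) * (max_simple_rank F1 * max_simple_rank F2))%N.
  (* Matrix-valued forms of [F1] and [F2]: the space [tspace (V1' ⊗ V2')] is a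
     space of matrices, but only after unfolding. *)
  pose f1 : {linear tspace (V1 ⊗ V2 ⊗ V3) -> 'M[cplx R]_(_, _)} := F1.
  pose f2 : {linear tspace (W1 ⊗ W2 ⊗ W3) -> 'M[cplx R]_(_, _)} := F2.
  rewrite !trank_mxrank -mxrank_tensmx -(kronecker_map_tprod f1 f2).
  by apply: mxrank_kronecker_border => x xs; rewrite -trank_mxrank trank_max_simple.
rewrite mulf_div -!natrM.
have [->|m_gt0] := posnP (max_simple_rank F1 * max_simple_rank F2).
  by rewrite invr0 mulr0 ler0n.
by rewrite ler_pdivrMr ?ltr0n // -natrM ler_nat.
Qed.
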